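(* Let $\mathcal{A}$ be a vector space over a field $\mathcal{K}$, and let $\mu:\mathcal{A}\otimes\mathcal{A}\otimes\mathcal{A}\to\mathcal{A}$ be a trilinear mapping, with dual mapping $\mu^{*}$. Then: (1) $(\mathcal{A},\mu)$ is a partially associative $3$-ary algebra if and only if $(\mathcal{A}^{*},\mu^{*})$ is a partially coassociative $3$-ary coalgebra. (2) $(\mathcal{A},\mu)$ is a totally associative $3$-ary algebra if and only if $(\mathcal{A}^{*},\mu^{*})$ is a totally coassociative $3$-ary coalgebra. (3) $(\mathcal{A},\mu)$ is a weak totally associative $3$-ary algebra if and only if $(\mathcal{A}^{*},\mu^{*})$ is a weak totally coassociative $3$-ary coalgebra.
   Context: $\mathcal{K}$ is a fixed field of characteristic zero; $\mathcal{A}^*$ is the dual space of $\mathcal{A}$ and $\langle\xi,x\rangle=\xi(x)$. The dual mapping $\mu^{*}:\mathcal{A}^{*}\to\mathcal{A}^{*}\otimes\mathcal{A}^{*}\otimes\mathcal{A}^{*}$ of $\mu$ is defined by $\langle\mu^{*}(\xi),x\otimes y\otimes z\rangle=\langle\xi,\mu(x,y,z)\rangle$ for $\xi\in\mathcal{A}^*$, $x,y,z\in\mathcal{A}$, where $\langle\xi\otimes\eta\otimes\gamma,x\otimes y\otimes z\rangle=\langle\xi,x\rangle\langle\eta,y\rangle\langle\gamma,z\rangle$. A vector space $V$ with a trilinear operation $\mu:V\otimes V\otimes V\to V$ is: a partially associative $3$-ary algebra if $\mu\circ(\mu\otimes\mathrm{id}\otimes\mathrm{id}+\mathrm{id}\otimes\mu\otimes\mathrm{id}+\mathrm{id}\otimes\mathrm{id}\otimes\mu)=0$;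 a totally associative $3$-ary algebra if $\mu\circ(\mu\otimes\mathrm{id}\otimes\mathrm{id})=\mu\circ(\mathrm{id}\otimes\mu\otimes\mathrm{id})=\mu\circ(\mathrm{id}\otimes\mathrm{id}\otimes\mu)$; a weak totally associative $3$-ary algebra if $\mu\circ(\mu\otimes\mathrm{id}\otimes\mathrm{id})=\mu\circ(\mathrm{id}\otimes\mathrm{id}\otimes\mu)$. A vector space $V$ with a linear map $\Delta:V\to V\otimes V\otimes V$ is: a partially coassociative $3$-ary coalgebra if $(\Delta\otimes\mathrm{id}\otimes\mathrm{id}+\mathrm{id}\otimes\Delta\otimes\mathrm{id}+\mathrm{id}\otimes\mathrm{id}\otimes\Delta)\circ\Delta=0$; a totally coassociative $3$-ary coalgebra if $(\Delta\otimes\mathrm{id}\otimes\mathrm{id})\circ\Delta=(\mathrm{id}\otimes\Delta\otimes\mathrm{id})\circ\Delta=(\mathrm{id}\otimes\mathrm{id}\otimes\Delta)\circ\Delta$; a weak totally coassociative $3$-ary coalgebra if $(\Delta\otimes\mathrm{id}\otimes\mathrm{id})\circ\Delta=(\mathrm{id}\otimes\mathrm{id}\otimes\Delta)\circ\Delta$. *)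

(* Defs.v *)
From HB Require Import structures.
From mathcomp Require Import all_boot all_algebra boolp.
From mathcomp.multinomials Require Import freeg.

Set Implicit Arguments.
Unset Strict Implicit.
Unset Printing Implicit Defensive.

Import GRing.Theory.
Local Open Scope ring_scope.
Local Open Scope quotient_scope.

Reserved Notation "V ⊗ W" (at level 40, left associativity).
Reserved Notation "v *t w" (at level 40, left associativity).

Section Dual.
Context {K : fieldType} (V : lmodType K).

Definition dual : Type := {linear V -> K^o}.

Definition dual_eval (xi : dual) (x : V) : K^o := (xi : {linear V -> K^o}) x.

Lemma dual_eval_linear xi : linear (dual_eval xi).
Proof. exact: linearP. Qed.
HB.instance Definition _ xi :=
  GRing.isLinear.Build K V K^o _ (dual_eval xi) (dual_eval_linear xi).

Lemma dual_ext (f g : dual) : dual_eval f =1 dual_eval g -> f = g.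
Proof.
case: f g => f [[a1] [b1]] [g [[a2] [b2]]] /funext /=.
rewrite /dual_eval /= => fg; case: g / fg a2 b2 => a2 b2.
by rewrite (Prop_irrelevance a1 a2) (Prop_irrelevance b1 b2).
Qed.

HB.instance Definition _ := gen_eqMixin dual.
HB.instance Definition _ := gen_choiceMixin dual.

Definition dual_zero : dual := (\0 : V -> K^o).
Definition dual_opp (f : dual) : dual := \- dual_eval f.
Definition dual_add (f g : dual) : dual := dual_eval f \+ dual_eval g.
Definition dual_scale (a : K) (f : dual) : dual := a \*: dual_eval f.

Lemma dual_addA : associative dual_add.
Proof. by move=> f g h; apply: dual_ext => x; exact: addrA. Qed.
Lemma dual_addC : commutative dual_add.
Proof. by move=> f g; apply: dual_ext => x; exact: addrC. Qed.
Lemma dual_add0 : left_id dual_zero dual_add.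
Proof. by move=> f; apply: dual_ext => x; exact: add0r. Qed.
Lemma dual_addN : left_inverse dual_zero dual_opp dual_add.
Proof. by move=> f; apply: dual_ext => x; exact: addNr. Qed.
HB.instance Definition _ :=
  GRing.isZmodule.Build dual dual_addA dual_addC dual_add0 dual_addN.

Lemma dual_scaleA a b (f : dual) :
  dual_scale a (dual_scale b f) = dual_scale (a * b) f.
Proof. by apply: dual_ext => x; exact: scalerA. Qed.
Lemma dual_scale1 : left_id 1 dual_scale.
Proof. by move=> f; apply: dual_ext => x; exact: scale1r. Qed.
Lemma dual_scaleDr : right_distributive dual_scale +%R.
Proof. by move=> a f g; apply: dual_ext => x; exact: scalerDr. Qed.
Lemma dual_scaleDl f : {morph dual_scale^~ f : a b / a + b}.
Proof. by move=> a b; apply: dual_ext => x; exact: scalerDl. Qed.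
HB.instance Definition _ := GRing.Zmodule_isLmodule.Build K dual
  dual_scaleA dual_scale1 dual_scaleDr dual_scaleDl.

Lemma dual_eval_bilinear :
  bilinear_for *:%R *:%R (dual_eval : dual -> V -> K^o).
Proof. by split=> [x a f g //|xi]; exact: dual_eval_linear. Qed.
HB.instance Definition _ :=
  bilinear_isBilinear.Build K dual V K^o *:%R *:%R dual_eval dual_eval_bilinear.

End Dual.

Section Tensor.
Context {K : fieldType} (V W : lmodType K).

(* The subspace of the free vector space on [V * W] spanned by the relations
   that make [(v, w) |-> << (v, w) >>] bilinear. *)
Inductive tensor_rel : {freeg (V * W)%type / K} -> Prop :=
| TensorRel0 : tensor_rel 0
| TensorRelP a s t : tensor_rel s -> tensor_rel t -> tensor_rel (a *: s + t)
| TensorRelL a v v' w :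
    tensor_rel (<< (a *: v + v', w) >> - (a *: << (v, w) >> + << (v', w) >>))
| TensorRelR a v w w' :
    tensor_rel (<< (v, a *: w + w') >> - (a *: << (v, w) >> + << (v, w') >>)).

Definition tensor_relb (s : {freeg (V * W)%type / K}) : bool :=
  `[< tensor_rel s >].

Lemma tensor_rel_zmod_closed : zmod_closed tensor_relb.
Proof.
split; first exact/asboolP/TensorRel0.
move=> s t /asboolP hs /asboolP ht; apply/asboolP.
by rewrite addrC -scaleN1r; exact: TensorRelP.
Qed.
HB.instance Definition _ :=
  GRing.isZmodClosed.Build _ tensor_relb tensor_rel_zmod_closed.

Definition tensor : Type :=
  Quotient.quot (GRing.ZmodClosed.clone _ tensor_relb _).
HB.instance Definition _ := GRing.Zmodule.on tensor.

Definition tensor_pi (s : {freeg (V * W)%type / K}) : tensor := \pi s.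

Lemma tensor_pi_zmod_morphism : zmod_morphism tensor_pi.
Proof. exact: raddfB. Qed.
HB.instance Definition _ :=
  GRing.isZmodMorphism.Build _ tensor tensor_pi tensor_pi_zmod_morphism.

Lemma tensor_pi_eq s t : tensor_rel (s - t) <-> tensor_pi s = tensor_pi t.
Proof.
apply: (iff_trans (rwP (asboolP _))).
have := Quotient.idealrBE (GRing.ZmodClosed.clone _ tensor_relb _) s t.
rewrite /in_mem /= /tensor_relb => ->.
exact: (iff_sym (rwP eqP)).
Qed.

Definition tensor_repr (t : tensor) : {freeg (V * W)%type / K} := repr t.
Lemma tensor_reprK : cancel tensor_repr tensor_pi.
Proof. exact: reprK. Qed.

Definition tensor_scale (a : K) (t : tensor) : tensor :=
  tensor_pi (a *: tensor_repr t).

Lemma tensor_scale_pi a s : tensor_scale a (tensor_pi s) = tensor_pi (a *: s).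
Proof.
apply/tensor_pi_eq; rewrite -scalerBr -[X in tensor_rel X]addr0.
apply: TensorRelP; last exact: TensorRel0.
by apply/tensor_pi_eq; rewrite tensor_reprK.
Qed.

Lemma tensor_scaleA a b t :
  tensor_scale a (tensor_scale b t) = tensor_scale (a * b) t.
Proof. by rewrite -[t]tensor_reprK !tensor_scale_pi scalerA. Qed.
Lemma tensor_scale1 : left_id 1 tensor_scale.
Proof. by move=> t; rewrite -[t]tensor_reprK tensor_scale_pi scale1r. Qed.
Lemma tensor_scaleDr : right_distributive tensor_scale +%R.
Proof.
move=> a s t; rewrite -[s]tensor_reprK -[t]tensor_reprK -raddfD.
by rewrite !tensor_scale_pi scalerDr raddfD.
Qed.
Lemma tensor_scaleDl t : {morph tensor_scale^~ t : a b / a + b}.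
Proof.
by move=> a b; rewrite -[t]tensor_reprK !tensor_scale_pi scalerDl raddfD.
Qed.
HB.instance Definition _ := GRing.Zmodule_isLmodule.Build K tensor
  tensor_scaleA tensor_scale1 tensor_scaleDr tensor_scaleDl.

Lemma tensor_pi_scalable : scalable tensor_pi.
Proof. by move=> a s; rewrite -tensor_scale_pi. Qed.
HB.instance Definition _ :=
  GRing.isScalable.Build _ _ _ _ tensor_pi tensor_pi_scalable.

Definition tens (v : V) (w : W) : tensor := tensor_pi << (v, w) >>.

Lemma tensor_piU k v w : tensor_pi << k *g (v, w) >> = k *: tens v w.
Proof.
rewrite -tensor_pi_scalable; congr tensor_pi.
by apply/eqP/freeg_eqP => y; rewrite coeffZ !coeffU mul1r.
Qed.

Lemma tens_bilinear : bilinear_for *:%R *:%R tens.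
Proof.
split=> [w a v v'|v a w w']; rewrite -linearP; apply/tensor_pi_eq.
  exact: TensorRelL.
exact: TensorRelR.
Qed.
HB.instance Definition _ :=
  bilinear_isBilinear.Build K V W tensor *:%R *:%R tens tens_bilinear.
HB.instance Definition _ v :=
  GRing.isLinear.Build K W tensor _ (tens v) (tens_bilinear.2 v).

Definition tensr (w : W) (v : V) : tensor := tens v w.
HB.instance Definition _ w :=
  GRing.isLinear.Build K V tensor _ (tensr w) (tens_bilinear.1 w).

Section Lift.
Context (U : lmodType K) (f : {bilinear V -> W -> U}).

Definition free_lift (s : {freeg (V * W)%type / K}) : U :=
  fglift (fun vw : V * W => f vw.1 vw.2) s.

Lemma free_liftU c v w : free_lift << c *g (v, w) >> = c *: f v w.
Proof. exact: liftU. Qed.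

Lemma free_liftD s t : free_lift (s + t) = free_lift s + free_lift t.
Proof.
have B : zmod_morphism free_lift := @lift_is_additive _ _ _ _.
have L0 : free_lift 0 = 0 by rewrite -(subrr 0) B subrr.
have LN u : free_lift (- u) = - free_lift u by rewrite -sub0r B L0 sub0r.
by rewrite -[in LHS](opprK t) B LN opprK.
Qed.

Lemma free_liftZ a s : free_lift (a *: s) = a *: free_lift s.
Proof.
elim/(@freeg_ind_dom0 K (V * W)%type): s => [|k [v w] s _ _ IHs].
  have L0 : free_lift 0 = 0 by apply: (addIr (free_lift 0)); rewrite -free_liftD !add0r.
  by rewrite scaler0 L0 scaler0.
have aU : a *: << k *g (v, w) >> = << (a * k) *g (v, w) >>
    :> {freeg (V * W)%type / K}.
  by apply/eqP/freeg_eqP => y; rewrite coeffZ !coeffU mulrA.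
by rewrite scalerDr aU !free_liftD IHs !free_liftU scalerDr scalerA.
Qed.

Lemma free_lift_linear : linear free_lift.
Proof. by move=> a s t; rewrite free_liftD free_liftZ. Qed.
HB.instance Definition _ :=
  GRing.isLinear.Build K _ U _ free_lift free_lift_linear.

Definition tensor_lift (t : tensor) : U := free_lift (tensor_repr t).

Lemma tensor_lift_pi s : tensor_lift (tensor_pi s) = free_lift s.
Proof.
apply/eqP; rewrite -subr_eq0 -raddfB /=; apply/eqP.
have: tensor_rel (tensor_repr (tensor_pi s) - s).
  by apply/tensor_pi_eq; rewrite tensor_reprK.
elim=> [|a s' t _ IHs _ IHt|a v v' w|a v w w'].
- exact: raddf0.
- by rewrite free_liftD free_liftZ IHs IHt scaler0 addr0.
- by rewrite raddfB /= free_liftD free_liftZ !free_liftU !scale1r linearPl subrr.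
- by rewrite raddfB /= free_liftD free_liftZ !free_liftU !scale1r linearPr subrr.
Qed.

Lemma tensor_lift_linear : linear tensor_lift.
Proof.
move=> a s t; rewrite -[s]tensor_reprK -[t]tensor_reprK -linearP /=.
by rewrite !tensor_lift_pi free_liftD free_liftZ.
Qed.
HB.instance Definition _ :=
  GRing.isLinear.Build K tensor U _ tensor_lift tensor_lift_linear.

Lemma tensor_liftE v w : tensor_lift (tens v w) = f v w.
Proof. by rewrite tensor_lift_pi free_liftU scale1r. Qed.

End Lift.

End Tensor.

Notation "V ⊗ W" := (tensor V W).
Notation "v *t w" := (tens v w) : ring_scope.

Lemma tensor_hom_ext (K : fieldType) (V W U : lmodType K)
    (f g : {linear V ⊗ W -> U}) :
  (forall v w, f (v *t w) = g (v *t w)) -> f =1 g.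
Proof.
move=> fg t; rewrite -[t]tensor_reprK; move: (tensor_repr t) => s.
elim/(@freeg_ind_dom0 K (V * W)%type): s => [|k [v w] s _ _ IHs].
  by rewrite !raddf0.
by rewrite raddfD /= tensor_piU !linearP /= IHs fg.
Qed.

(* [tensor_map f g] is the map usually written [f ⊗ g]. *)
Section TensorMap.
Context {K : fieldType} {V V' W W' : lmodType K}.
Context (f : {linear V -> V'}) (g : {linear W -> W'}).

Definition tens_map (v : V) (w : W) : V' ⊗ W' := f v *t g w.

Lemma tens_map_bilinear : bilinear_for *:%R *:%R tens_map.
Proof.
by split=> [w a v v'|v a w w']; rewrite /tens_map linearP ?linearPl ?linearPr.
Qed.
HB.instance Definition _ := bilinear_isBilinear.Build K V W (V' ⊗ W')
  *:%R *:%R tens_map tens_map_bilinear.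

Definition tensor_map (t : V ⊗ W) : V' ⊗ W' := tensor_lift tens_map t.
HB.instance Definition _ := GRing.Linear.copy tensor_map (tensor_lift tens_map).

Lemma tensor_mapE v w : tensor_map (v *t w) = f v *t g w.
Proof. exact: tensor_liftE. Qed.

End TensorMap.

(* The associator and its inverse. *)
Section Assoc.
Context {K : fieldType} {U V W : lmodType K}.

Definition tens_assocl (u : U) (t : V ⊗ W) : (U ⊗ V) ⊗ W :=
  tensor_map (tens u) idfun t.
Definition tens_assocr (t : U ⊗ V) (w : W) : U ⊗ (V ⊗ W) :=
  tensor_map idfun (tensr w) t.

Lemma tens_assocl_bilinear : bilinear_for *:%R *:%R tens_assocl.
Proof.
split=> [t a u u'|u]; last exact: linearP.
apply: (@tensor_hom_ext _ _ _ _ (tensor_map (tens (a *: u + u')) idfun)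
  (a \*: tensor_map (tens u) idfun \+ tensor_map (tens u') idfun)) => v w /=.
by rewrite !tensor_mapE /= linearPl linearPl.
Qed.
HB.instance Definition _ := bilinear_isBilinear.Build K U (V ⊗ W)
  ((U ⊗ V) ⊗ W) *:%R *:%R tens_assocl tens_assocl_bilinear.

Lemma tens_assocr_bilinear : bilinear_for *:%R *:%R tens_assocr.
Proof.
split=> [w|t a w w']; first exact: linearP.
apply: (@tensor_hom_ext _ _ _ _ (tensor_map idfun (tensr (a *: w + w')))
  (a \*: tensor_map idfun (tensr w) \+ tensor_map idfun (tensr w'))) => u v /=.
by rewrite !tensor_mapE /= /tensr (tens_bilinear V W).2 (tens_bilinear U _).2.
Qed.
HB.instance Definition _ := bilinear_isBilinear.Build K (U ⊗ V) W
  (U ⊗ (V ⊗ W)) *:%R *:%R tens_assocr tens_assocr_bilinear.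

Definition assocl : U ⊗ (V ⊗ W) -> (U ⊗ V) ⊗ W := tensor_lift tens_assocl.
HB.instance Definition _ := GRing.Linear.copy assocl (tensor_lift tens_assocl).

Definition assocr : (U ⊗ V) ⊗ W -> U ⊗ (V ⊗ W) := tensor_lift tens_assocr.
HB.instance Definition _ := GRing.Linear.copy assocr (tensor_lift tens_assocr).

Lemma assoclE u v w : assocl (u *t (v *t w)) = (u *t v) *t w.
Proof. by rewrite /assocl tensor_liftE; exact: tensor_mapE. Qed.

Lemma assocrE u v w : assocr ((u *t v) *t w) = u *t (v *t w).
Proof. by rewrite /assocr tensor_liftE; exact: tensor_mapE. Qed.

End Assoc.

(* The pairing of [V' ⊗ W'] with [V ⊗ W] induced by pairings [p] and [q], i.e.
   <xi ⊗ eta, v ⊗ w> = p(xi, v) q(eta, w). *)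
Section Pairing.
Context {K : fieldType} {V' V W' W : lmodType K}.
Context (p : {bilinear V' -> V -> K^o}) (q : {bilinear W' -> W -> K^o}).

Definition pure_pairing (xi : V') (eta : W') (v : V) (w : W) : K^o :=
  p xi v * q eta w.

Lemma pure_pairing_bilinear xi eta :
  bilinear_for *:%R *:%R (pure_pairing xi eta).
Proof.
rewrite /pure_pairing; split=> [w a v v'|v a w w'].
  by rewrite linearPr mulrDl -scalerAl.
by rewrite linearPr mulrDr -scalerAr.
Qed.
HB.instance Definition _ xi eta := bilinear_isBilinear.Build K V W K^o
  *:%R *:%R (pure_pairing xi eta) (pure_pairing_bilinear xi eta).

Definition half_pairing (t : V ⊗ W) (xi : V') (eta : W') : K^o :=
  tensor_lift (pure_pairing xi eta) t.

Lemma half_pairing_bilinear t : bilinear_for *:%R *:%R (half_pairing t).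
Proof.
split=> [eta a xi xi'|xi a eta eta'].
  apply: (@tensor_hom_ext _ _ _ _ (tensor_lift (pure_pairing (a *: xi + xi') eta))
    (a \*: tensor_lift (pure_pairing xi eta) \+
       tensor_lift (pure_pairing xi' eta))) => v w /=.
  by rewrite !tensor_liftE /= /pure_pairing linearPl mulrDl -scalerAl.
apply: (@tensor_hom_ext _ _ _ _ (tensor_lift (pure_pairing xi (a *: eta + eta')))
  (a \*: tensor_lift (pure_pairing xi eta) \+
     tensor_lift (pure_pairing xi eta'))) => v w /=.
by rewrite !tensor_liftE /= /pure_pairing linearPl mulrDr -scalerAr.
Qed.
HB.instance Definition _ t := bilinear_isBilinear.Build K V' W' K^o
  *:%R *:%R (half_pairing t) (half_pairing_bilinear t).

Definition tensor_pairing (s : V' ⊗ W') (t : V ⊗ W) : K^o :=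
  tensor_lift (half_pairing t) s.

Lemma tensor_pairing_bilinear : bilinear_for *:%R *:%R tensor_pairing.
Proof.
split=> [t|s a t t']; first exact: linearP.
apply: (@tensor_hom_ext _ _ _ _ (tensor_lift (half_pairing (a *: t + t')))
  (a \*: tensor_lift (half_pairing t) \+
     tensor_lift (half_pairing t'))) => xi eta /=.
by rewrite !tensor_liftE /= /half_pairing linearP.
Qed.
HB.instance Definition _ := bilinear_isBilinear.Build K (V' ⊗ W') (V ⊗ W) K^o
  *:%R *:%R tensor_pairing tensor_pairing_bilinear.

Lemma tensor_pairingE xi eta v w :
  tensor_pairing (xi *t eta) (v *t w) = p xi v * q eta w.
Proof. by rewrite /tensor_pairing tensor_liftE; exact: tensor_liftE. Qed.

End Pairing.

Lemma tensor_sum {K : fieldType} (V W : lmodType K) (s : V ⊗ W) :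
  exists n (v : 'I_n -> V) (w : 'I_n -> W), s = \sum_i (v i *t w i).
Proof.
rewrite -[s]tensor_reprK; move: (tensor_repr s) => {}s.
elim/(@freeg_ind_dom0 K (V * W)%type): s => [|k [v0 w0] s _ _ [n [v [w sE]]]].
  by exists 0, (fun=> 0), (fun=> 0); rewrite big_ord0 raddf0.
exists n.+1, (fun i => oapp v (k *: v0) (unlift ord0 i)),
  (fun i => oapp w w0 (unlift ord0 i)).
rewrite big_ord_recl unlift_none /= raddfD /= sE; congr (_ + _).
  by rewrite linearZl_LR; exact: tensor_piU.
by apply: eq_bigr => i _; rewrite liftK.
Qed.

Lemma tensor_pairing_nondegenerate {K : fieldType} (V' V W' W : lmodType K)
    (p : {bilinear V' -> V -> K^o}) (q : {bilinear W' -> W -> K^o}) :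
  (forall xi, (forall v, p xi v = 0) -> xi = 0) ->
  (forall eta, (forall w, q eta w = 0) -> eta = 0) ->
  forall s, (forall v w, tensor_pairing p q s (v *t w) = 0) -> s = 0.
Proof.
move=> p0 q0 s s0.
have [n [xi [eta sE]]] : exists n (xi : 'I_n -> V') (eta : 'I_n -> W'),
    s = \sum_i (xi i *t eta i).
  exact: tensor_sum.
elim: n => [|n IHn] in xi eta sE *; first by rewrite sE big_ord0.
have pE v w : \sum_i p (xi i) v * q (eta i) w = 0.
  transitivity (tensor_pairing p q s (v *t w)); last exact: s0.
  rewrite sE -[RHS]/(tensor_lift (half_pairing p q (v *t w)) _).
  rewrite [RHS]linear_sum; apply: eq_bigr => i _.
  by rewrite -[RHS]/(tensor_pairing p q _ _) tensor_pairingE.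
have [[i0 [w nz]]|eta0] := pselect (exists i0 w, q (eta i0) w != 0); last first.
  rewrite sE big1 // => i _; rewrite [eta i]q0 ?linear0r // => w.
  by apply/eqP/negP => /negP h; apply: eta0; exists i, w.
pose c i := q (eta i) w / q (eta i0) w.
have xiE : xi i0 = - \sum_i c (fintype.lift i0 i) *: xi (fintype.lift i0 i).
  apply/eqP; rewrite -addr_eq0; apply/eqP/p0 => v.
  transitivity ((\sum_i p (xi i) v * q (eta i) w) / q (eta i0) w); last first.
    by rewrite pE mul0r.
  rewrite linearDl linear_sumlz (bigop.bigD1_ord i0) //= mulrDl mulfK // mulr_suml; congr (_ + _).
  apply: eq_bigr => i _; rewrite linearZl_LR /= /c.
  by rewrite -[LHS]/(_ * _) [p _ _ * _]mulrC mulrAC.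
apply: (IHn (fun i => xi (fintype.lift i0 i))
  (fun i => eta (fintype.lift i0 i) - c (fintype.lift i0 i) *: eta i0)).
rewrite sE (bigop.bigD1_ord i0) //= xiE linearNl linear_sumlz -sumrN -big_split /=.
apply: eq_bigr => i _.
by rewrite linearZl_LR linearBr linearZr_LR /= addrC.
Qed.

Notation tensor3 V := (V ⊗ V ⊗ V) (only parsing).
Notation tensor5 V := (V ⊗ V ⊗ V ⊗ V ⊗ V) (only parsing).

Section Ternary.
Context {K : fieldType} {V : lmodType K}.

(* The identifications of [X ⊗ V ⊗ V ⊗ V] with [X ⊗ (V ⊗ V ⊗ V)]. *)
Definition group3 {X : lmodType K} : X ⊗ V ⊗ V ⊗ V -> X ⊗ tensor3 V :=
  assocr \o tensor_map assocr idfun.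
Definition ungroup3 {X : lmodType K} : X ⊗ tensor3 V -> X ⊗ V ⊗ V ⊗ V :=
  tensor_map assocl idfun \o assocl.
HB.instance Definition _ X :=
  GRing.Linear.copy (@group3 X) (assocr \o tensor_map assocr idfun).
HB.instance Definition _ X :=
  GRing.Linear.copy (@ungroup3 X) (tensor_map assocl idfun \o assocl).

Section Algebra.
Context (mu : {linear tensor3 V -> V}).

(* [mu ⊗ id ⊗ id], [id ⊗ mu ⊗ id] and [id ⊗ id ⊗ mu]. *)
Definition mu_l : tensor5 V -> tensor3 V :=
  tensor_map (tensor_map mu idfun) idfun.
Definition mu_m : tensor5 V -> tensor3 V :=
  tensor_map (tensor_map idfun mu) idfun \o tensor_map group3 idfun.
Definition mu_r : tensor5 V -> tensor3 V :=
  tensor_map (tensor_map idfun idfun) mu \o group3.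

Definition partially_associative : Prop :=
  mu \o (mu_l \+ mu_m \+ mu_r) =1 \0.

Definition totally_associative : Prop :=
  mu \o mu_l =1 mu \o mu_m /\ mu \o mu_m =1 mu \o mu_r.

Definition weak_totally_associative : Prop := mu \o mu_l =1 mu \o mu_r.

End Algebra.

Section Coalgebra.
Context (delta : {linear V -> tensor3 V}).

(* [delta ⊗ id ⊗ id], [id ⊗ delta ⊗ id] and [id ⊗ id ⊗ delta]. *)
Definition delta_l : tensor3 V -> tensor5 V :=
  tensor_map (tensor_map delta idfun) idfun.
Definition delta_m : tensor3 V -> tensor5 V :=
  tensor_map ungroup3 idfun \o tensor_map (tensor_map idfun delta) idfun.
Definition delta_r : tensor3 V -> tensor5 V :=
  ungroup3 \o tensor_map (tensor_map idfun idfun) delta.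

Definition partially_coassociative : Prop :=
  (delta_l \+ delta_m \+ delta_r) \o delta =1 \0.

Definition totally_coassociative : Prop :=
  delta_l \o delta =1 delta_m \o delta /\
  delta_m \o delta =1 delta_r \o delta.

Definition weak_totally_coassociative : Prop :=
  delta_l \o delta =1 delta_r \o delta.

End Coalgebra.
End Ternary.

Definition pairing3 {K : fieldType} (V : lmodType K) :
    tensor3 (dual V) -> tensor3 V -> K^o :=
  tensor_pairing (tensor_pairing (@dual_eval K V) (@dual_eval K V))
    (@dual_eval K V).

Lemma pairing3E {K : fieldType} (V : lmodType K) (xi eta gam : dual V) x y z :
  pairing3 (xi *t eta *t gam) (x *t y *t z) =
    dual_eval xi x * dual_eval eta y * dual_eval gam z.
Proof. by rewrite /pairing3 tensor_pairingE /= tensor_pairingE. Qed.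

Lemma pairing3_nondegenerate {K : fieldType} (A : lmodType K)
    (s : tensor3 (dual A)) :
  (forall x y z, pairing3 s (x *t y *t z) = 0) -> s = 0.
Proof.
have d0 (xi : dual A) : (forall x, dual_eval xi x = 0) -> xi = 0.
  by move=> xi0; apply: dual_ext => x; rewrite xi0.
pose d : {bilinear dual A -> A -> K^o} := @dual_eval K A.
pose dd : {bilinear _ -> _ -> K^o} := tensor_pairing d d.
have dd0 := @tensor_pairing_nondegenerate _ _ _ _ _ d d d0 d0.
move=> s0; apply: (@tensor_pairing_nondegenerate _ _ _ _ _ dd d) => //.
  by move=> t t0; apply: dd0 => v w; exact: t0.
move=> v z; pose B := tensor_pairing_bilinear dd d.
pose f : {linear A ⊗ A -> K^o} := HB.pack (fun v => tensor_pairing dd d s (v *t z))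
  (GRing.isLinear.Build K _ _ _ (fun v => tensor_pairing dd d s (v *t z))
   (fun a u v => etrans (congr1 (tensor_pairing dd d s) ((tens_bilinear (A ⊗ A) A).1 z a u v))
     (B.2 s a (u *t z) (v *t z)))).
have fE : f =1 (\0 : A ⊗ A -> K^o).
  by apply: tensor_hom_ext => x y; exact: s0.
exact: fE.
Qed.

(* In finite dimension [mu'] exists; otherwise [xi \o mu : tensor3 A -> K] may
   fail to come from [tensor3 (dual A)]. *)
Definition is_dual_mapping {K : fieldType} {A : lmodType K}
    (mu : {linear tensor3 A -> A})
    (mu' : {linear dual A -> tensor3 (dual A)}) : Prop :=
  forall (xi : dual A) (x y z : A),
    pairing3 (mu' xi) (x *t y *t z) = dual_eval xi (mu (x *t y *t z)).

Lemma dual_mapping_unique {K : fieldType} (A : lmodType K)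
    (mu : {linear tensor3 A -> A})
    (mu' mu'' : {linear dual A -> tensor3 (dual A)}) :
  is_dual_mapping mu mu' -> is_dual_mapping mu mu'' -> mu' =1 mu''.
Proof.
move=> H' H'' xi; apply/eqP; rewrite -subr_eq0; apply/eqP.
apply: pairing3_nondegenerate => x y z.
by rewrite /pairing3 linearBl -/(pairing3 _ _) [X in X - _]H' [X in _ - X]H'' subrr.
Qed.

Lemma dual_mapping_exists {K : fieldType} (A : vectType K)
    (mu : {linear tensor3 A -> A}) :
  exists mu' : {linear dual A -> tensor3 (dual A)}, is_dual_mapping mu mu'.
Proof.
pose n := \dim {:A}; pose e : n.-tuple A := vbasis {:A}.
pose e' (i : 'I_n) : dual A := coord e i.
pose c (xi : dual A) (i j k : 'I_n) : K :=
  dual_eval xi (mu (e`_i *t e`_j *t e`_k)).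
pose mu' (xi : dual A) : tensor3 (dual A) :=
  \sum_i \sum_j \sum_k c xi i j k *: (e' i *t e' j *t e' k).
have mu'_linear : linear mu'.
  move=> a xi eta; rewrite /mu' scaler_sumr -big_split; apply: eq_bigr => i _ /=.
  rewrite scaler_sumr -big_split; apply: eq_bigr => j _ /=.
  rewrite scaler_sumr -big_split; apply: eq_bigr => k _ /=.
  by rewrite scalerDl scalerA.
pose M := GRing.isLinear.Build K _ _ _ mu' mu'_linear.
pose mu'L : {linear dual A -> tensor3 (dual A)} := HB.pack mu' M.
exists mu'L => xi x y z; rewrite -[mu'L xi]/(mu' xi).
have eE v : v = \sum_i coord e i v *: e`_i by apply: coord_vbasis; rewrite memvf.
have lin_e (f : {linear A -> K^o}) v : f v = \sum_i coord e i v * f e`_i.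
  by rewrite {1}(eE v) linear_sum; apply: eq_bigr => i _; rewrite linearZ.
pose g : {linear tensor3 A -> K^o} := dual_eval xi \o mu.
pose P := (pairing3 (V := A))^~ (x *t y *t z).
have P_linear : linear (P : _ -> K^o).
  exact: (tensor_pairing_bilinear _ _).1.
pose PM := GRing.isLinear.Build K _ _ _ P P_linear.
pose PL : {linear tensor3 (dual A) -> K^o} := HB.pack P PM.
rewrite -[LHS]/(PL (\sum_i \sum_j \sum_k _)) -[RHS]/(g (x *t y *t z)).
pose g1 : {linear A -> K^o} := g \o (tensr z \o tensr y).
rewrite -[RHS]/(g1 x) lin_e (linear_sum PL); apply: eq_bigr => i _.
pose g2 : {linear A -> K^o} := g \o (tensr z \o tens e`_i).
rewrite -[X in _ * X]/(g2 y) lin_e (linear_sum PL) mulr_sumr; apply: eq_bigr => j _.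
pose g3 : {linear A -> K^o} := g \o tens (e`_i *t e`_j).
rewrite -[X in _ * (_ * X)]/(g3 z) lin_e (linear_sum PL) !mulr_sumr.
apply: eq_bigr => k _; rewrite linearZ /= /P pairing3E.
by rewrite -[LHS]/(c xi i j k * _) mulrC !mulrA.
Qed.

(* Main.v *)
From HB Require Import structures.
Require Import Defs.
From mathcomp Require Import all_boot all_algebra.
From mathcomp Require Import boolp classical_sets.

Set Implicit Arguments.
Unset Strict Implicit.
Unset Printing Implicit Defensive.

Import GRing.Theory.
Local Open Scope ring_scope.

(* The pairings of [tensor3 (dual A)] with [tensor3 A] and of
   [tensor5 (dual A)] with [tensor5 A] make [mu' ⊗ id ⊗ id], [id ⊗ mu' ⊗ id] and
   [id ⊗ id ⊗ mu'] adjoint to [mu ⊗ id ⊗ id], [id ⊗ mu ⊗ id] and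
   [id ⊗ id ⊗ mu], so that each composite [d \o mu'] is adjoint to the
   corresponding [mu \o m]. One side vanishes iff the other does, because an
   element of [tensor5 (dual A)] is determined by its pairings and, by Zorn's
   lemma, linear forms separate the points of [A] in any dimension. *)

(** * Separating the points of [A] by linear forms *)

Section Separation.
Context {K : fieldType} (A : lmodType K).

(** Zorn's lemma gives a maximal subspace missing [a]; maximality forces it to be a complement of
    the line [K a]. *)
Lemma subspace_avoiding_maximal (a : A) : a != 0 ->
  exists M : set A, [/\ M 0, ~ M a,
    forall c u v, M u -> M v -> M (c *: u + v) &
    forall v, exists c, M (v - c *: a)].
Proof.
move=> a0.
(* The empty set satisfies [P], which covers the union of the empty chain. *)
pose P (S : set A) := ~ S a /\ forall c u v, S u -> S v -> S (c *: u + v).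
have [F FP totF|M [[Ma Mlin] Mmax]] := @Zorn_bigcup A P.
  split=> [[S FS Sa]|c u v [S FS Su] [T FT Tv]]; first exact: (FP _ FS).1 Sa.
  have [ST|TS] := totF _ _ FS FT.
    by exists T => //; apply: (FP _ FT).2 => //; exact: ST.
  by exists S => //; apply: (FP _ FS).2 => //; exact: TS.
have M0 : M 0.
  have [[u Mu]|M0] := pselect (exists u, M u).
    by have := Mlin (-1) u u Mu Mu; rewrite scaleN1r addNr.
  (* An empty [M] would be properly contained in [{0}], which misses [a]. *)
  case: (Mmax [set 0]%classic); last first.
    split=> [/= aE|c u v /= -> ->]; first by rewrite aE eqxx in a0.
    by rewrite scaler0 addr0.
  split=> [u Mu|/(_ 0 erefl) Mu]; by case: M0; eexists; exact: Mu.
have MZ c u : M u -> M (c *: u) by move=> /(Mlin c)/(_ M0); rewrite addr0.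
exists M; split=> // v.
have [Mv|Mv] := pselect (M v); first by exists 0; rewrite scale0r subr0.
(* [N] is [M + K v]. If it contains [a], dividing by the coefficient of [v] puts [v] in [M + K a];
   otherwise it contradicts the maximality of [M]. *)
pose N : set A := fun w => exists c, M (w - c *: v).
have [[c Mc]|Na] := pselect (N a).
  have c0 : c != 0.
    by apply/eqP => c0; move: Mc; rewrite c0 scale0r subr0.
  exists c^-1; have := MZ (- c^-1) _ Mc.
  by rewrite scalerBr scalerA mulNr mulVf // scaleN1r opprK scaleNr addrC.
case: (Mmax N).
  split=> [u Mu|NM]; first by exists 0; rewrite scale0r subr0.
  by apply/Mv/NM; exists 1; rewrite scale1r subrr.
split=> // c u w [d Md] [e Me]; exists (c * d + e).
have := Mlin c _ _ Md Me.
by rewrite scalerBr scalerA scalerDl opprD addrACA.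
Qed.

(* [f v] is the coefficient of [a] in the decomposition [A = M ⊕ K a]. *)
Lemma dual_separates (a : A) : (forall xi : dual A, dual_eval xi a = 0) -> a = 0.
Proof.
move=> xia; apply/eqP/negP => /negP/subspace_avoiding_maximal.
move=> [M [M0 Ma Mlin /choice[f Mf]]].
have f_unique v c : M (v - c *: a) -> f v = c.
  move=> Mc; apply/eqP; rewrite -subr_eq0; apply/negP => /negP nz; apply: Ma.
  (* Subtracting the two decompositions of [v] leaves [(f v - c) *: a] in [M]; rescaling puts [a]
     itself there. *)
  have := Mlin (-1) _ _ (Mf v) Mc.
  rewrite scaleN1r opprB addrA subrK -scalerBl => /(Mlin (f v - c)^-1)/(_ M0).
  by rewrite addr0 scalerA mulVf // scale1r.
have f_linear : linear (f : A -> K^o).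
  move=> c u v; apply: f_unique; have := Mlin c _ _ (Mf u) (Mf v).
  by rewrite scalerBr scalerA scalerDl opprD addrACA.
pose xi : dual A := HB.pack (f : A -> K^o)
  (GRing.isLinear.Build K A K^o _ _ f_linear).
(* The form [xi] takes the value 1 at [a], since [a - 1 *: a = 0] lies in [M]. *)
have := xia xi; rewrite -[dual_eval _ _]/(f a) (f_unique a 1).
  by move/eqP; rewrite oner_eq0.
by rewrite scale1r subrr.
Qed.

End Separation.

(** * Adjoint maps between tensor products *)

Section Adjoint.
Context {K : fieldType}.

(** Scalars are absorbed into a factor, so every tensor is a sum of pure ones; the empty sum is
    [0 *t 0]. *)
Lemma tensor_ind (V W : lmodType K) (P : V ⊗ W -> Prop) :
    (forall v w, P (v *t w)) -> (forall s t, P s -> P t -> P (s + t)) ->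
  forall s, P s.
Proof.
move=> Ppure PD s; have [n [v [w ->]]] := tensor_sum s.
apply: big_ind => //; have <- : 0 *t 0 = 0 :> V ⊗ W by rewrite linear0r.
exact: Ppure.
Qed.

Lemma tensor_pairing_adjoint (V1' V1 V2' V2 W1' W1 W2' W2 : lmodType K)
    (p1 : {bilinear V1' -> V1 -> K^o}) (p2 : {bilinear V2' -> V2 -> K^o})
    (q1 : {bilinear W1' -> W1 -> K^o}) (q2 : {bilinear W2' -> W2 -> K^o})
    (f' : {linear V1' -> V2'}) (f : {linear V2 -> V1})
    (g' : {linear W1' -> W2'}) (g : {linear W2 -> W1}) :
  (forall xi v, p2 (f' xi) v = p1 xi (f v)) ->
  (forall xi v, q2 (g' xi) v = q1 xi (g v)) ->
  forall s t, tensor_pairing p2 q2 (tensor_map f' g' s) t =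
              tensor_pairing p1 q1 s (tensor_map f g t).
Proof.
move=> fE gE s t.
elim/tensor_ind: s => [xi eta|s1 s2 IH1 IH2]; last first.
  by rewrite linearD !linearDl; congr (_ + _).
elim/tensor_ind: t => [v w|t1 t2 IH1 IH2]; last first.
  by rewrite linearD !linearDr; congr (_ + _).
by rewrite !tensor_mapE !tensor_pairingE fE gE.
Qed.

(** On pure tensors this is associativity of multiplication in [K]. *)
Lemma assoc_adjoint (U' U V' V W' W : lmodType K)
    (p : {bilinear U' -> U -> K^o}) (q : {bilinear V' -> V -> K^o})
    (r : {bilinear W' -> W -> K^o}) s t :
  tensor_pairing (tensor_pairing p q) r (assocl s) t =
  tensor_pairing p (tensor_pairing q r) s (assocr t).
Proof.
elim/tensor_ind: s => [xi s|s1 s2 IH1 IH2]; last first.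
  by rewrite linearD !linearDl; congr (_ + _).
elim/tensor_ind: s => [eta gam|s1 s2 IH1 IH2]; last first.
  by rewrite linearDr linearD !linearDl; congr (_ + _).
elim/tensor_ind: t => [t w|t1 t2 IH1 IH2]; last first.
  by rewrite linearD !linearDr; congr (_ + _).
elim/tensor_ind: t => [u v|t1 t2 IH1 IH2]; last first.
  by rewrite linearDl linearD !linearDr; congr (_ + _).
by rewrite assoclE assocrE !tensor_pairingE /= !tensor_pairingE mulrA.
Qed.

(** Testing against all tensors gives the conclusion the same form as the hypotheses, so that the
    lemma can be iterated. *)
Lemma tensor_pairing_separates (V' V W' W : lmodType K)
    (p : {bilinear V' -> V -> K^o}) (q : {bilinear W' -> W -> K^o}) :
  (forall xi, (forall v, p xi v = 0) -> xi = 0) ->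
  (forall eta, (forall w, q eta w = 0) -> eta = 0) ->
  forall s, (forall t, tensor_pairing p q s t = 0) -> s = 0.
Proof.
move=> p0 q0 s s0.
by apply: (tensor_pairing_nondegenerate p0 q0) => v w; exact: s0.
Qed.

End Adjoint.

(** * Duality for the ternary operations *)

Section TernaryDuality.
Context {K : fieldType} {A : lmodType K}.

Let ev : {bilinear dual A -> A -> K^o} := @dual_eval K A.
Let pair2 : {bilinear _ -> _ -> K^o} := tensor_pairing ev ev.
Let pair3 : {bilinear tensor3 (dual A) -> tensor3 A -> K^o} :=
  tensor_pairing pair2 ev.
Let pair4 : {bilinear _ -> _ -> K^o} := tensor_pairing pair3 ev.
Let pair5 : {bilinear tensor5 (dual A) -> tensor5 A -> K^o} :=
  tensor_pairing pair4 ev.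

Lemma pairing5_nondegenerate (s : tensor5 (dual A)) :
  (forall t, pair5 s t = 0) -> s = 0.
Proof.
have ev0 (xi : dual A) : (forall x, ev xi x = 0) -> xi = 0.
  by move=> xi0; apply: dual_ext => x; exact: xi0.
by move: s; do 4![apply: tensor_pairing_separates => //].
Qed.

(** [X] is arbitrary because it is [A] for the middle insertion and [A ⊗ A] for the right one. *)
Lemma group3_adjoint (X' X : lmodType K) (p : {bilinear X' -> X -> K^o}) s t :
  tensor_pairing (tensor_pairing (tensor_pairing p ev) ev) ev (ungroup3 s) t =
  tensor_pairing p pair3 s (group3 t).
Proof.
rewrite /ungroup3 /group3 /=.
(* The pairing of the intermediate stage [X ⊗ (A ⊗ A) ⊗ A] splits the claim into two
   reassociations. *)
rewrite (@tensor_pairing_adjoint _ _ _ _ _ _ _ _ _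
  (tensor_pairing p pair2) _ ev _ _ assocr _ idfun) //.
  exact: assoc_adjoint.
by move=> *; exact: assoc_adjoint.
Qed.

Context (mu : {linear tensor3 A -> A}).
Context (mu' : {linear dual A -> tensor3 (dual A)}).
Context (mu_dual : is_dual_mapping mu mu').

Lemma dual_mapping_adjoint xi t : pair3 (mu' xi) t = ev xi (mu t).
Proof.
elim/(@tensor_ind K): t => [t z|t1 t2 IH1 IH2]; last first.
  by rewrite (linearD mu) !linearDr; congr (_ + _).
elim/(@tensor_ind K): t => [x y|t1 t2 IH1 IH2]; last first.
  by rewrite linearDl (linearD mu) !linearDr; congr (_ + _).
exact: mu_dual.
Qed.

Lemma delta_l_adjoint s t : pair5 (delta_l mu' s) t = pair3 s (mu_l mu t).
Proof.
apply: tensor_pairing_adjoint => // s1 t1.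
apply: tensor_pairing_adjoint => // xi x; exact: dual_mapping_adjoint.
Qed.

Lemma delta_m_adjoint s t : pair5 (delta_m mu' s) t = pair3 s (mu_m mu t).
Proof.
rewrite /delta_m /mu_m /=.
rewrite (@tensor_pairing_adjoint _ _ _ _ _ _ _ _ _
  (tensor_pairing ev pair3) _ ev _ _ group3 _ idfun) //.
  apply: tensor_pairing_adjoint => // s1 t1.
  apply: tensor_pairing_adjoint => // xi x; exact: dual_mapping_adjoint.
by move=> *; exact: group3_adjoint.
Qed.

Lemma delta_r_adjoint s t : pair5 (delta_r mu' s) t = pair3 s (mu_r mu t).
Proof.
rewrite /delta_r /mu_r /= [LHS]group3_adjoint.
apply: tensor_pairing_adjoint => // s1 t1; last exact: dual_mapping_adjoint.
exact: tensor_pairing_adjoint.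
Qed.

(** Taking [d] and [m] as plain functions lets this apply directly to sums and differences of the
    insertions. *)
Lemma dual_composite_eq0 (d : tensor3 (dual A) -> tensor5 (dual A))
    (m : tensor5 A -> tensor3 A) :
  (forall s t, pair5 (d s) t = pair3 s (m t)) ->
  (mu \o m =1 (fun=> 0)) <-> (d \o mu' =1 (fun=> 0)).
Proof.
move=> dm; have dmE xi t : pair5 (d (mu' xi)) t = ev xi (mu (m t)).
  by rewrite dm dual_mapping_adjoint.
split=> [m0 xi /=|d0 t /=].
  by apply: pairing5_nondegenerate => t; rewrite dmE [mu _]m0 linear0r.
by apply: dual_separates => xi; rewrite -[LHS]dmE [d _]d0 linear0l.
Qed.

Lemma dual_composite_eq (d1 d2 : tensor3 (dual A) -> tensor5 (dual A))
    (m1 m2 : tensor5 A -> tensor3 A) :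
  (forall s t, pair5 (d1 s) t = pair3 s (m1 t)) ->
  (forall s t, pair5 (d2 s) t = pair3 s (m2 t)) ->
  (mu \o m1 =1 mu \o m2) <-> (d1 \o mu' =1 d2 \o mu').
Proof.
move=> dm1 dm2.
have dm s t : pair5 (d1 s - d2 s) t = pair3 s (m1 t - m2 t).
  by rewrite linearBl linearBr dm1 dm2.
have [md dmm] := dual_composite_eq0 (d := fun s => d1 s - d2 s)
  (m := fun t => m1 t - m2 t) dm.
split=> [m12 xi|d12 t] /=; apply/eqP; rewrite -subr_eq0; apply/eqP.
  by apply: md => t /=; rewrite linearB [X in X - _]m12 subrr.
by rewrite -linearB; apply: dmm => xi /=; rewrite [X in X - _]d12 subrr.
Qed.

End TernaryDuality.

Theorem theorem2p10 (K : fieldType) (charK : [pchar K] =i pred0)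
    (A : lmodType K) (mu : {linear tensor3 A -> A})
    (mu' : {linear dual A -> tensor3 (dual A)})
    (mu_dual : is_dual_mapping mu mu') :
  [/\ partially_associative mu <-> partially_coassociative mu',
      totally_associative mu <-> totally_coassociative mu' &
      weak_totally_associative mu <-> weak_totally_coassociative mu'].
Proof.
have [[l m] r] := (delta_l_adjoint mu_dual, delta_m_adjoint mu_dual,
                 delta_r_adjoint mu_dual).
have lm := dual_composite_eq mu_dual l m.
have mr := dual_composite_eq mu_dual m r.
split; last exact: (dual_composite_eq mu_dual l r).
  (* Bilinearity of the pairings makes the sums of the three insertions adjoint. *)
  apply: (dual_composite_eq0 mu_dual) => s t /=.
  by rewrite !linearDl !linearDr l m r.
by split=> -[/lm ? /mr ?].
Qed.
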